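(* Let $(X,\mathcal F,\mu)$ be a $\sigma$-finite measure space, let $M_u$ be a positive multiplication operator and $C_\varphi$ a bounded composition operator on $L^2(\mu)$. Let $J=h_\varphi\cdot E(u)\circ\varphi^{-1}$ and $S=\{x\in X:J(x)\ne0\}$. Then $C_\varphi$ is an $M_u$-partial isometry on $L^2(\mu)$ if and only if $$\int_X(J-u)|f|^2\,d\mu=0\quad\text{for all } f\in\left(u\,L^2(X\setminus S)\right)^\perp.$$
   Context: A positive multiplication operator is $M_uf=u\cdot f$ with $u$ essentially bounded, measurable and $u\ge0$ a.e. The map $\varphi:X\to X$ is measurable and non-singular ($\mu\circ\varphi^{-1}\ll\mu$), and $C_\varphi f=f\circ\varphi$. $h_\varphi=\frac{d(\mu\circ\varphi^{-1})}{d\mu}$. $E(f)=E(f\mid\varphi^{-1}(\mathcal F))$ is the conditional expectation with respect to $\varphi^{-1}(\mathcal F)$ and $\mu$ (defined for $f\in L^2(\mu)$ and for nonnegative measurable $f$). $E(f)\circ\varphi^{-1}$ denotes the measurable function $g$, unique a.e. on $\{h_\varphi\ne0\}$ and taken to be $0$ elsewhere, with $g\circ\varphi=E(f)$ a.e. $L^2(X\setminus S)$ is the subspace of functions in $L^2(\mu)$ vanishing a.e. on $S$; $uL^2(X\setminus S)=\{ug:g\in L^2(X\setminus S)\}$; $\perp$ is the usual orthogonal complement in $L^2(\mu)$. For a positive bounded operator $A$ on a Hilbert space $\mathcal H$: $\langle f,g\rangle_A=\langle Af,g\rangle$, $\|f\|_A=\langle f,f\rangle_A^{1/2}$; $\mathcal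 L^{\perp_A}=\{f:\langle f,g\rangle_A=0\ \forall g\in\mathcal L\}$; $\mathcal N_A(T)=\{f:\|Tf\|_A=0\}=\mathcal N(A^{1/2}T)$. A bounded operator $T$ is an $A$-partial isometry if $\|Tf\|_A=\|f\|_A$ for all $f\in\mathcal N_A(T)^{\perp_A}$. *)

(* Defs.v *)
From HB Require Import structures.
From mathcomp Require Import all_boot all_order all_algebra.
From mathcomp Require Import all_classical all_reals all_analysis.
From mathcomp Require Import measurable_realfun complex.
Set Implicit Arguments.
Unset Strict Implicit.
Unset Printing Implicit Defensive.
Import Order.TTheory GRing.Theory Num.Theory.
Import numFieldNormedType.Exports.
Import ComplexField.Normc.
Local Open Scope classical_set_scope.
Local Open Scope ring_scope.

(* The scalar field is R[i].  Elements of L^2 are represented by functions;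
   every notion below depends on them only up to a.e. equality (for the
   composition operator, because phi is non-singular). *)

Section L2.
Context d (X : measurableType d) (R : realType).
Variable mu : {measure set X -> \bar R}.
Implicit Types (f g : X -> R[i]) (L S : set (X -> R[i])).
Implicit Types (A T : (X -> R[i]) -> (X -> R[i])).

Definition Cmeasurable f :=
  measurable_fun setT (fun x => complex.Re (f x)) /\
  measurable_fun setT (fun x => complex.Im (f x)).

Definition Cintegral f : R[i] :=
  Complex (\int[mu]_x complex.Re (f x)) (\int[mu]_x complex.Im (f x)).

Definition L2norm f : \bar R := Lnorm mu 2%:E (fun x => (normc (f x))%:E).

Definition L2 : set (X -> R[i]) :=
  [set f | Cmeasurable f /\ (L2norm f < +oo)%E].

Definition inner f g : R[i] := Cintegral (fun x => f x * conjc (g x)).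

Definition orth L : set (X -> R[i]) :=
  [set f | L2 f /\ forall g, L g -> inner f g = 0].

(* L2_off B is the space L^2(X \ B) *)
Definition L2_off (B : set X) : set (X -> R[i]) :=
  [set f | L2 f /\ {ae mu, forall x, B x -> f x = 0}].

Definition bounded_op T :=
  (forall f, L2 f -> L2 (T f)) /\
  exists M : R, forall f, L2 f -> (L2norm (T f) <= M%:E * L2norm f)%E.

Definition innerA A f g : R[i] := inner (A f) g.

(* <f, f>_A is a nonnegative real when A is positive *)
Definition normA A f : R[i] := sqrtc (innerA A f f).

Definition orthA A L : set (X -> R[i]) :=
  [set f | L2 f /\ forall g, L g -> innerA A f g = 0].

Definition kerA A T : set (X -> R[i]) := [set f | L2 f /\ normA A (T f) = 0].

Definition partial_isometryA A T :=
  bounded_op T /\ forall f, orthA A (kerA A T) f -> normA A (T f) = normA A f.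

Definition mult_op (u : X -> R) f : X -> R[i] := fun x => (u x)%:C%C * f x.

Definition comp_op (phi : X -> X) f : X -> R[i] := f \o phi.

End L2.

Section derivatives.
Context d (X : measurableType d) (R : realType).
Variables (mu : {measure set X -> \bar R}) (phi : X -> X).
Implicit Types f g h : X -> \bar R.
Local Open Scope ereal_scope.

(* The library's 'd nu '/d mu requires nu to be finite, which mu o phi^-1 need
   not be.  The derivative, like the other functions obtained by "get" below, is
   a chosen representative; "get" returns a default value if there is none,
   which does not happen when mu is sigma-finite and the composition operator
   of phi is bounded. *)
Definition is_RN_derivative (nu : set X -> \bar R) h :=
  [/\ measurable_fun setT h, (forall x, 0 <= h x) &
      forall B, measurable B -> nu B = \int[mu]_(x in B) h x].

Definition RN_derivative (nu : set X -> \bar R) : X -> \bar R :=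
  get (is_RN_derivative nu).

Definition hphi : X -> \bar R := RN_derivative (pushforward mu phi).

(* g is a version of E(f | phi^-1(F)), for f nonnegative a.e. *)
Definition is_cond_exp f g :=
  [/\ measurable_fun setT (g : g_sigma_algebra_preimageType phi -> \bar R),
      (forall x, 0 <= g x) &
      forall B, g_sigma_algebra_preimage phi B ->
        \int[mu]_(x in B) g x = \int[mu]_(x in B) f x].

Definition cond_exp f : X -> \bar R := get (is_cond_exp f).

Definition is_comp_inv f g :=
  [/\ measurable_fun setT g, (forall x, hphi x = 0 -> g x = 0) &
      {ae mu, forall x, g (phi x) = f x}].

(* "f o phi^-1", for f measurable with respect to phi^-1(F) *)
Definition comp_inv f : X -> \bar R := get (is_comp_inv f).

Definition Jfun (u : X -> R) : X -> \bar R :=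
  fun x => hphi x * comp_inv (cond_exp (EFin \o u)) x.

End derivatives.

(* Main.v *)
Require Import Defs.
From HB Require Import structures.
From mathcomp Require Import all_boot all_order all_algebra.
From mathcomp Require Import all_classical all_reals all_analysis.
From mathcomp Require Import measurable_realfun ess_sup_inf complex ring.
Import Order.TTheory GRing.Theory Num.Theory.
Import numFieldNormedType.Exports.
Import ComplexField.Normc.
Local Open Scope classical_set_scope.
Local Open Scope ring_scope.
Set Implicit Arguments.
Unset Strict Implicit.
Unset Printing Implicit Defensive.

(** The function J is the density with respect to mu of the image under phi of
    the measure u mu.  Indeed, with h the derivative of mu o phi^-1 and
    g o phi = E(u), integrating over the preimage of B gives
<<
      int_(phi^-1 B) u = int_(phi^-1 B) E(u) = int_(phi^-1 B) g o phi
                       = int_B g h = int_B J,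
>>
    and therefore int u |f o phi|^2 = int J |f|^2 for all f in L^2: the squared
    M_u-seminorm of C_phi f is the integral of J |f|^2 (ge0_integral_Jfun,
    weighted_sqnorm_comp_op).

    The theorem then follows in three remarks.  This integral vanishes exactly
    when f = 0 a.e. on S = [J <> 0], so the M_u-kernel of C_phi is L^2(X \ S)
    (kerA_comp_op).  As M_u is symmetric, the M_u-orthogonal complement of a set
    L is the orthogonal complement of u L (orthA_mult_op).  Finally C_phi
    preserves the M_u-seminorm of f exactly when int J |f|^2 = int u |f|^2, and
    both integrals are finite, so that they can be subtracted
    (integral_Jfun_sub).

    Most of the work is in the existence of h, E(u) and g.  Boundedness of
    C_phi, tested on indicators, makes mu o phi^-1 sigma-finite (preimage_lty),
    so that h exists by a Radon-Nikodym theorem between two sigma-finite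
    measures (radon_nikodym_both_sigma_finite).  The same theorem applied to the
    images under phi of u mu and mu gives E(u) (cond_expP), and the Doob-Dynkin
    factorization turns any version of E(u) into some g o phi
    (doob_dynkin_factor, comp_invP). *)

(** * Measures with a density *)

Section densities.
Context d (T : measurableType d) (R : realType).
Implicit Types (m : {measure set T -> \bar R}) (f k : T -> \bar R).
Local Open Scope ereal_scope.
Import HBNNSimple.

Lemma density_measure_exists m k :
  measurable_fun setT k -> (forall x, 0 <= k x) ->
  exists nu : {measure set T -> \bar R}, forall B, nu B = \int[m]_(x in B) k x.
Proof.
move=> mk k0; pose nu (B : set T) := \int[m]_(x in B) k x.
have nu0 : nu set0 = 0 by rewrite /nu integral_set0.
have nu_ge0 B : 0 <= nu B by apply: integral_ge0 => x _; exact: k0.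
have nuS : semi_sigma_additive nu by exact: semi_sigma_additive_nng_induced.
pose mix := isMeasure.Build _ _ _ nu nu0 nu_ge0 nuS.
pose nu' : {measure set T -> \bar R} := HB.pack nu mix.
by exists nu'.
Qed.

(** Multiplication by +oo is not continuous on the extended reals, so the case
    c = +oo is where monotonicity is used: either v vanishes identically, or
    v n * +oo = +oo from some rank on.  Infinite values of c must be allowed, as
    a Radon-Nikodym derivative or a conditional expectation may take them on a
    null set. *)
Lemma cvge_mulr_nondecreasing (v : (\bar R)^nat) l c :
  (forall n, 0 <= v n) -> {homo v : n p / (n <= p)%N >-> n <= p} ->
  v @ \oo --> l -> 0 <= c -> (fun n => v n * c) @ \oo --> l * c.
Proof.
move=> v0 vnd vl; case: c => [r r0|_|//].
  exact: cvgeZr.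
have vle n : v n <= l.
  apply: cvge_ge vl; near=> p; apply: vnd; near: p; exact: nbhs_infty_ge.
have [v_eq0|] := pselect (forall n, v n = 0).
  have -> : l = 0.
    apply: cvg_unique vl _ => //.
    by rewrite (_ : v = cst 0); [exact: cvg_cst|exact/funext].
  by apply: cvg_near_cst; apply: nearW => n; rewrite v_eq0 !mul0e.
move=> /existsNP[n /eqP vn0].
have vn_gt0 : 0 < v n by rewrite lt0e vn0 v0.
apply: cvg_near_cst; near=> p.
have vp_gt0 : 0 < v p.
  by apply: lt_le_trans vn_gt0 (vnd _ _ _); near: p; exact: nbhs_infty_ge.
by rewrite !gt0_muley// (lt_le_trans vp_gt0).
Unshelve. all: by end_near. Qed.

(** By linearity the identity passes from indicators to simple functions, and by
    monotone convergence to nonnegative functions. *)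
Lemma ge0_integral_density m k (nu : {measure set T -> \bar R}) f :
  measurable_fun setT k -> (forall x, 0 <= k x) ->
  (forall B, measurable B -> nu B = \int[m]_(x in B) k x) ->
  measurable_fun setT f -> (forall x, 0 <= f x) ->
  \int[nu]_x f x = \int[m]_x (f x * k x).
Proof.
move=> mk k0 nuE mf f0; pose h := nnsfun_approx measurableT mf.
have hf x : EFin \o h^~ x @ \oo --> f x by exact: cvg_nnsfun_approx.
have hnd x : {homo (fun n => (h n x)%:E) : n p / (n <= p)%N >-> n <= p}.
  by move=> n p np; rewrite lee_fin; exact/lefP/nd_nnsfun_approx.
have h_int n : \int[nu]_x (h n x)%:E = \int[m]_x ((h n x)%:E * k x).
  rewrite integralT_nnsfun sintegralE.
  transitivity (\int[m]_x
     (\sum_(y \in range (h n)) (y%:E * (k \_ (h n @^-1` [set y])) x))).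
    rewrite ge0_integral_fsum//=; last 2 first.
    - move=> y; apply: measurable_funeM; apply/measurable_restrict => //.
      by rewrite setTI; exact: measurable_funTS.
    - move=> y x _; have [y0|y0] := leP 0%R y.
        by rewrite mule_ge0// erestrict_ge0.
      by rewrite preimage_nnfun0// patch_set0 mule0.
    apply: eq_fsbigr => y; rewrite inE => -[t _ yE].
    have y0 : (0 <= y)%R by rewrite -yE.
    rewrite ge0_integralZl//=; last 2 first.
    - apply/measurable_restrict => //.
      by rewrite setTI; exact: measurable_funTS.
    - by move=> x _; exact: erestrict_ge0.
    by rewrite -integral_mkcond nuE.
  apply: eq_integral => x _.
  rewrite (fsbigD1 (h n x))//=; last by exists x.
  rewrite patchE mem_set// fsbig1 ?adde0// => y [_ /= yh].
  by rewrite patchE memNset ?mule0// => /= /esym.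
have mh n : measurable_fun setT (fun x => (h n x)%:E) by exact/measurable_EFinP.
transitivity (limn (fun n => \int[nu]_x (h n x)%:E)).
  rewrite -monotone_convergence//.
    by apply: eq_integral => x _; apply/esym/cvg_lim => //; exact: hf.
  by move=> n x _; rewrite lee_fin.
under eq_fun do rewrite h_int.
rewrite -monotone_convergence//.
- apply: eq_integral => x _; apply/cvg_lim => //.
  apply: cvge_mulr_nondecreasing => //; last exact: hf.
  by move=> n; rewrite lee_fin.
- by move=> n; exact: emeasurable_funM.
- by move=> n x _; rewrite mule_ge0// lee_fin.
- by move=> x _ n p np; rewrite lee_wpmul2r//; exact: hnd.
Qed.

(** The measure nu = mu o phi^-1 of interest need not be finite.  Cutting the
    space into pieces of finite nu-measure reduces the claim to finite nu; the
    derivatives of the pieces add up. *)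
Lemma radon_nikodym_both_sigma_finite
    (m : {sigma_finite_measure set T -> \bar R})
    (nu : {measure set T -> \bar R}) :
  sigma_finite setT nu -> nu `<< m ->
  exists k, is_RN_derivative m nu k.
Proof.
move=> [F FT /all_and2[mF nuF]] num.
pose E := seqDU F.
have mE j : measurable (E j).
  by apply: measurableD => //; exact: bigsetU_measurable.
have nuE j : nu (E j) < +oo.
  by rewrite (le_lt_trans _ (nuF j))// le_measure ?inE//; exact: subDsetl.
have ET : \bigcup_j E j = [set: T] by rewrite FT [RHS]seqDU_bigcup_eq.
pose nu_ j : {finite_measure set T -> \bar R} := mfrestr (mE j) (nuE j).
have nu_m j : nu_ j `<< m.
  apply/null_content_dominatesP => B mB mB0.
  move/null_content_dominatesP : num; apply; first exact: measurableI.
  by apply: subset_measure0 mB0 => //; exact: measurableI.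
have [k_] := choice (fun j => radon_nikodym_sigma_finite (nu_m j)).
move=> /all_and4[k_ge0 _ ik_ int_k].
have mk_ j : measurable_fun setT (k_ j) by exact: measurable_int (ik_ j).
exists (fun x => \sum_(j <oo) k_ j x); split.
- exact: ge0_emeasurable_sum.
- by move=> x; exact: nneseries_ge0.
- move=> B mB; rewrite integral_nneseries//; last first.
    by move=> j; exact: measurable_funTS.
  transitivity (\sum_(j <oo) nu (B `&` E j)); last first.
    by apply: eq_eseriesr => j _; rewrite -int_k.
  rewrite -[B in LHS]setIT -ET setI_bigcupr measure_bigcup//.
  + by apply: eq_eseriesl => j; rewrite in_setT.
  + by move=> j _; exact: measurableI.
  + exact/trivIset_setIl/trivIset_seqDU.
Qed.

(** Doob-Dynkin factorization.  Each set [g > r], r rational, is the preimage of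
    some C r; then k y is the supremum of 0 and of the r >= 0 with y in C r. *)
Lemma doob_dynkin_factor (d' : measure_display) (T' : measurableType d')
    (phi : T -> T') (g : T -> \bar R) :
  measurable_fun setT (g : g_sigma_algebra_preimageType phi -> \bar R) ->
  (forall x, 0 <= g x) ->
  exists2 k : T' -> \bar R, measurable_fun setT k & forall x, k (phi x) = g x.
Proof.
move=> mg g0.
(* The rationals are enumerated by their codes; absolute values make every term
   of the supremum nonnegative, and junk codes contribute 0. *)
pose r n : R :=
  if (unpickle n : option rat) is Some q then `|ratr q|%R else 0%R.
have r0 n : (0 <= r n)%R by rewrite /r; case: unpickle.
have /choice[C] n : exists B,
    measurable B /\ phi @^-1` B = [set x | (r n)%:E < g x].
  have : measurable
      ([set x | (r n)%:E < g x] : set (g_sigma_algebra_preimageType phi)).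
    rewrite -[X in measurable X]setTI.
    exact: (emeasurable_fun_o_infty _ mg).
  by move=> [B mB]; rewrite setTI => BE; exists B.
move=> /all_and2[mC CE].
pose v n y := if y \in C n then (r n)%:E else 0%R : \bar R.
have v0 n y : 0 <= v n y by rewrite /v; case: ifPn; rewrite // lee_fin.
exists (fun y => esups (v ^~ y) 0%N).
  apply: measurable_fun_esups => n; apply: measurable_fun_ifT => //.
  by apply: (measurable_fun_bool true); rewrite setTI preimage_mem_true.
move=> x; apply/eqP; rewrite eq_le; apply/andP; split.
  apply: ge_ereal_sup => _ [n _ <-]; rewrite /v; case: ifPn => // /set_mem Cx.
  by have : (phi @^-1` C n) x by []; rewrite CE => /ltW.
have v_sup n : v n (phi x) <= esups (v ^~ (phi x)) 0%N.
  by apply: ereal_sup_ubound; exists n.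
rewrite leNgt; apply/negP => sg.
have [q q0 /andP[sq qg]] : exists2 q : rat, (0 <= ratr q :> R)%R &
    esups (v ^~ (phi x)) 0%N < (ratr q)%:E < g x.
  have := le_trans (v0 0%N _) (v_sup 0%N).
  case: (esups _ _) sg => [a| |]//; last by case: (g x).
  move=> ag; rewrite lee_fin => a0.
  have [b ab bg] : exists2 b, (a < b)%R & b%:E <= g x.
    case: (g x) ag => [b| |]//; first by rewrite lte_fin => ?; exists b.
    by exists (a + 1)%R; rewrite ?ltrDl ?leey.
  have [q] := rat_in_itvoo ab; rewrite in_itv/= => /andP[aq qb].
  exists q; first exact: le_trans (ltW aq).
  by rewrite lte_fin aq/= (lt_le_trans _ bg)// lte_fin.
have rq : r (pickle q) = ratr q by rewrite /r pickleK ger0_norm.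
have Cq : C (pickle q) (phi x).
  by rewrite -[C _ _]/((phi @^-1` C (pickle q)) x) CE /= rq.
by have := v_sup (pickle q); rewrite /v mem_set// rq leNgt sq.
Qed.
End densities.

(** * Square-integrable functions *)

Section L2_facts.
Context d (X : measurableType d) (R : realType).
Variable mu : {measure set X -> \bar R}.
Implicit Types f g : X -> R[i].

Lemma sqr_normcE (z : R[i]) :
  normc z ^+ 2 = complex.Re z ^+ 2 + complex.Im z ^+ 2.
Proof. by case: z => a b /=; rewrite sqr_sqrtr ?addr_ge0 ?sqr_ge0. Qed.

Lemma measurable_sqr_normc f : Cmeasurable f ->
  measurable_fun setT (fun x => normc (f x) ^+ 2).
Proof.
move=> [mRe mIm]; under eq_fun do rewrite sqr_normcE.
by apply: measurable_funD; exact: measurable_funX.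
Qed.

Lemma L2P f : L2 mu f <->
  Cmeasurable f /\ (\int[mu]_x (normc (f x) ^+ 2)%:E < +oo)%E.
Proof.
have normE : (L2norm mu f `^ 2 = \int[mu]_x (normc (f x) ^+ 2)%:E)%E.
  rewrite poweR_Lnorm//; apply: eq_integral => x _.
  by rewrite poweR_EFin powR_mulrn// real_normK// num_real.
split=> -[mf fin]; split=> //; first by rewrite -normE poweR_lty.
rewrite /L2norm unlock poweR_lty//; move: fin; rewrite -normE.
by rewrite poweR_Lnorm.
Qed.

End L2_facts.

(** * The image measure of a bounded composition operator *)

Section pushforward.
Context d (X : measurableType d) (R : realType).
Variables (mu : {sigma_finite_measure set X -> \bar R}) (phi : X -> X).
Hypothesis phi_meas : measurable_fun setT phi.
Hypothesis Cphi : forall f, L2 mu f -> L2 mu (comp_op phi f).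

Lemma measurable_preimage B : measurable B -> measurable (phi @^-1` B).
Proof. by move=> mB; rewrite -[X in measurable X]setTI; exact: phi_meas. Qed.

(** The indicator of B lies in L^2, hence so does its composition with phi,
    which is the indicator of the preimage of B.  So mu o phi^-1 inherits
    sigma-finiteness from mu, which is what makes h and E(u) exist. *)
Lemma preimage_lty B : measurable B -> (mu B < +oo)%E ->
  (mu (phi @^-1` B) < +oo)%E.
Proof.
move=> mB muB.
have normE x : normc ((\1_B x : R)%:C)%C ^+ 2 = \1_B x :> R.
  rewrite sqr_normcE/= expr0n addr0 indicE.
  by case: (_ \in _); rewrite ?expr1n ?expr0n.
have /Cphi /L2P[_] : L2 mu (fun x => (\1_B x)%:C)%C.
  apply/L2P; split.
    by split; [exact: measurable_indic|exact: measurable_cst].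
  under eq_integral do rewrite normE.
  by rewrite integral_indic// setIT.
under eq_integral do rewrite /comp_op/= normE.
by rewrite (integral_indic _ measurableT (measurable_preimage mB)) setIT.
Qed.

Lemma pushforward_measure_exists (m : {measure set X -> \bar R}) :
  exists nu : {measure set X -> \bar R},
    nu = pushforward m phi :> (set X -> \bar R).
Proof.
pose nu : {measure set X -> \bar R} := pushforward m phi.
by exists (nu phi_meas).
Qed.

Lemma pushforward_sigma_finite_exists :
  exists lam : {sigma_finite_measure set X -> \bar R},
    lam = pushforward mu phi :> (set X -> \bar R).
Proof.
have [nu nuE] := pushforward_measure_exists mu.
have nu_sf : sigma_finite setT nu.
  have [F FT /all_and2[mF muF]] := sigma_finiteT mu.
  exists F => // j; split=> //; rewrite nuE.
  exact: (preimage_lty (mF j) (muF j)).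
pose sfin := isSFinite.Build _ _ _ _ (sfinite_measure_sigma_finite nu_sf).
pose sigmafin := isSigmaFinite.Build _ _ _ _ nu_sf.
pose lam : {sigma_finite_measure set X -> \bar R} :=
  HB.pack (Measure.sort nu) sfin sigmafin.
by exists lam; rewrite -nuE.
Qed.

End pushforward.

(** * The weight J *)

Section Radon_Nikodym_of_composition.
Context d (X : measurableType d) (R : realType).
Variables (mu : {sigma_finite_measure set X -> \bar R}) (phi : X -> X).
Hypothesis phi_meas : measurable_fun setT phi.
Hypothesis phi_nonsingular : pushforward mu phi `<< mu.
Hypothesis Cphi : forall f, L2 mu f -> L2 mu (comp_op phi f).
Local Open Scope ereal_scope.

Lemma ge0_integral_pushforward_measure (m lam : {measure set X -> \bar R})
    D (f : X -> \bar R) :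
  lam = pushforward m phi :> (set X -> \bar R) -> measurable D ->
  measurable_fun setT f -> (forall x, 0 <= f x) ->
  \int[lam]_(x in D) f x = \int[m]_(x in phi @^-1` D) f (phi x).
Proof.
move=> lamE mD mf f0.
rewrite -[RHS](ge0_integral_pushforward phi_meas m mD (measurable_funTS mf))//.
by apply: eq_measure_integral => B mB _; rewrite lamE.
Qed.

Lemma hphiP : is_RN_derivative mu (pushforward mu phi) (hphi mu phi).
Proof.
have [lam lamE] := pushforward_sigma_finite_exists phi_meas Cphi.
have lam_mu : lam `<< mu by rewrite lamE.
apply: getPex; rewrite -lamE.
exact: radon_nikodym_both_sigma_finite (sigma_finiteT lam) lam_mu.
Qed.

Let h := hphi mu phi.
Let mh : measurable_fun setT h. Proof. by case: hphiP. Qed.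
Let mh0 : measurable [set x | h x = 0].
Proof.
rewrite -[X in measurable X]setTI.
exact: mh measurableT _ (emeasurable_set1 0).
Qed.
Let h0 x : 0 <= h x. Proof. by case: hphiP. Qed.

Lemma ge0_integral_comp D (f : X -> \bar R) : measurable D ->
  measurable_fun setT f -> (forall x, 0 <= f x) ->
  \int[mu]_(x in phi @^-1` D) f (phi x) = \int[mu]_(x in D) (f x * h x).
Proof.
move=> mD mf f0.
have [lam lamE] := pushforward_measure_exists phi_meas mu.
rewrite -(ge0_integral_pushforward_measure lamE mD mf f0).
rewrite [LHS]integral_mkcond [RHS]integral_mkcond.
rewrite (@ge0_integral_density _ _ _ mu h)//.
- by apply: eq_integral => x _; rewrite !patchE; case: ifPn; rewrite ?mul0e.
- by move=> B mB; rewrite lamE; case: hphiP => _ _ ->.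
- by apply/measurable_restrict => //; rewrite setTI; exact: measurable_funTS.
- by move=> x; exact: erestrict_ge0.
Qed.

Variable u : X -> R.
Hypothesis u_meas : measurable_fun setT u.
Hypothesis u_ge0 : {ae mu, forall x, (0 <= u x)%R}.
Variable M : R.
Hypothesis u_le : {ae mu, forall x, (u x <= M)%R}.

Let U := (EFin \o u)^\+.
Let mU : measurable_fun setT U.
Proof. by apply: measurable_funepos; exact/measurable_EFinP. Qed.
Let U0 x : 0 <= U x. Proof. exact: funepos_ge0. Qed.

Lemma ae_eq_funepos_u : {ae mu, forall x, U x = (u x)%:E}.
Proof.
apply: filterS u_ge0 => x ux0; rewrite /U funeposE/=.
by apply/max_idPl; rewrite lee_fin.
Qed.

Lemma integral_funepos_u B : measurable B ->
  \int[mu]_(x in B) (EFin \o u) x = \int[mu]_(x in B) U x.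
Proof.
move=> mB; apply: ae_eq_integral => //.
- by apply: measurable_funTS; exact/measurable_EFinP.
- exact: measurable_funTS.
- by apply: filterS ae_eq_funepos_u => x Ux _; rewrite Ux.
Qed.

(** The conditional expectation is built on the target of phi: k o phi, with k
    the derivative of the image of u mu with respect to the image of mu, is
    measurable for phi^-1(F) by construction and has the right integrals. *)
Lemma cond_expP :
  is_cond_exp mu phi (EFin \o u) (cond_exp mu phi (EFin \o u)).
Proof.
apply: getPex.
have [lam lamE] := pushforward_sigma_finite_exists phi_meas Cphi.
have [nuU nuUE] := density_measure_exists mu mU U0.
have [nu nuE] := pushforward_measure_exists phi_meas nuU.
have nu_sf : sigma_finite setT nu.
  have [F FT /all_and2[mF muF]] := sigma_finiteT mu.
  exists F => // j; split=> //; rewrite nuE /pushforward nuUE.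
  have mphiF := measurable_preimage phi_meas (mF j).
  have /le_lt_trans : \int[mu]_(x in phi @^-1` F j) U x <=
      \int[mu]_(x in phi @^-1` F j) `|M|%:E.
    apply: ae_ge0_le_integral => //.
    - exact: measurable_funTS.
    - apply: filterS2 u_le ae_eq_funepos_u => x uM -> _.
      by rewrite lee_fin (le_trans uM)// ler_norm.
  apply; rewrite integral_cst// lte_mul_pinfty//.
  exact: (preimage_lty phi_meas Cphi (mF j) (muF j)).
have nu_lam : nu `<< lam.
  apply/null_content_dominatesP => B mB lamB0.
  have B0 : mu (phi @^-1` B) = 0.
    by rewrite -[LHS]/(pushforward mu phi B) -lamE.
  rewrite nuE /pushforward nuUE; apply: null_set_integral => //.
  - exact: measurable_preimage.
  - exact: measurable_funTS.
have [k [mk k0 kE]] := radon_nikodym_both_sigma_finite nu_sf nu_lam.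
exists (k \o phi); split; [|by move=> x; exact: k0|].
- move=> _ B mB; rewrite setTI comp_preimage.
  exists (k @^-1` B); last by rewrite setTI.
  by rewrite -[X in measurable X]setTI; exact: mk.
- move=> _ [C mC <-]; rewrite setTI.
  rewrite integral_funepos_u; last exact: measurable_preimage.
  rewrite -nuUE -/(pushforward nuU phi C) -nuE kE//.
  by rewrite (ge0_integral_pushforward_measure lamE).
Qed.

Let Eu := cond_exp mu phi (EFin \o u).

(** The set [h = 0] is null for h mu = mu o phi^-1.  Hence prescribing the value
    0 on it does not affect E(u) o phi^-1 after composition with phi. *)
Lemma hphi_comp_ae_neq0 : {ae mu, forall x, h (phi x) != 0}.
Proof.
have [_ _ hE] := hphiP.
exists (phi @^-1` [set x | h x = 0]); split.
- exact: measurable_preimage.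
- rewrite -/(pushforward mu phi _) hE// (eq_integral (cst 0)) ?integral0//.
  by move=> x /set_mem.
- by move=> x /= /negP; rewrite negbK => /eqP.
Qed.

Lemma comp_invP : is_comp_inv mu phi Eu (comp_inv mu phi Eu).
Proof.
apply: getPex; have [mE E0 _] := cond_expP.
have [k mk kE] := doob_dynkin_factor mE E0.
exists (fun y => if h y == 0 then 0 else k y); split.
- apply: measurable_fun_ifT => //.
  apply: (measurable_fun_bool true).
  rewrite setTI (_ : _ @^-1` _ = h @^-1` [set 0]); last first.
    by apply/seteqP; split=> x /= /eqP.
  exact: mh0.
- by move=> x hx0; rewrite /h hx0 eqxx.
- by apply: filterS hphi_comp_ae_neq0 => x /negbTE ->.
Qed.

Let g := comp_inv mu phi Eu.
Let J := Jfun mu phi u.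

Lemma measurable_Jfun : measurable_fun setT J.
Proof. by apply: emeasurable_funM => //; case: comp_invP. Qed.

(** Off the essential range of phi the function g = E(u) o phi^-1 may be
    negative, but h vanishes a.e. there: the negative part of g integrates to 0
    against h, since g o phi = E(u) >= 0. *)
Lemma Jfun_ge0 : {ae mu, forall x, 0 <= J x}.
Proof.
have [mg _ gE] := comp_invP.
have [_ E0 _] := cond_expP.
have mgn : measurable_fun setT g^\- by exact: measurable_funeneg.
have : \int[mu]_x (g^\- x * h x) = 0.
  rewrite -(ge0_integral_comp measurableT)// preimage_setT.
  rewrite (ae_eq_integral (cst 0)) ?integral0//.
    exact: measurableT_comp.
  apply: filterS gE => x gx _; rewrite /= /g funenegE/= gx.
  by apply/max_idPr; rewrite oppe_le0.
under eq_integral => x _ do rewrite -[_ * _]gee0_abs ?mule_ge0//.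
move=> /ae_eq_integral_abs => /(_ measurableT (emeasurable_funM mgn mh)).
apply: filterS => x /(_ I)/eqP; rewrite mule_eq0 => /orP[|/eqP hx0].
  rewrite funenegE => /eqP gn0; rewrite /J /Jfun mule_ge0//.
  by rewrite -oppe_le0 -gn0 le_max lexx.
by rewrite /J /Jfun -/h hx0 mul0e.
Qed.

(** On the preimages of sets both sides integrate E(u), since g o phi = E(u); so
    J is the density of the image under phi of the measure u mu, and the
    identity extends from sets to functions. *)
Lemma ge0_integral_Jfun (f : X -> \bar R) :
  measurable_fun setT f -> (forall x, 0 <= f x) ->
  \int[mu]_x (f x * J^\+ x) = \int[mu]_x (f (phi x) * U x).
Proof.
move=> mf f0.
have [mg _ gE] := comp_invP.
have [mE E0 EE] := cond_expP.
have mgp : measurable_fun setT g^\+ by exact: measurable_funepos.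
have mJ := measurable_Jfun.
have [nuU nuUE] := density_measure_exists mu mU U0.
have [nu nuE] := pushforward_measure_exists phi_meas nuU.
transitivity (\int[nu]_x f x).
  rewrite (@ge0_integral_density _ _ _ mu J^\+)//.
  - exact: measurable_funepos.
  - move=> B mB; rewrite nuE /pushforward nuUE.
    have mphiB := measurable_preimage phi_meas mB.
    rewrite -integral_funepos_u// -EE; last by exists B => //; rewrite setTI.
    transitivity (\int[mu]_(x in phi @^-1` B) g^\+ (phi x)).
      apply: ge0_ae_eq_integral => //.
      - apply: measurable_funTS => _ C mC.
        have [D mD] := mE measurableT C mC.
        by rewrite !setTI => <-; exact: measurable_preimage.
      - by apply: measurable_funTS; exact: measurableT_comp.
      - apply: filterS gE => x gx _; rewrite funeposE /g gx.
        by apply/esym/max_idPl.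
    rewrite ge0_integral_comp//; apply: eq_integral => x _.
    rewrite !funeposE /J /Jfun -/h -/g muleC.
    have [gx0|/ltW gx0] := leP 0 (g x); first by rewrite max_l// mule_ge0.
    by rewrite mule0 max_r// mule_ge0_le0.
rewrite (ge0_integral_pushforward_measure nuE measurableT mf f0) preimage_setT.
by rewrite (@ge0_integral_density _ _ _ mu U)//; exact: measurableT_comp.
Qed.

End Radon_Nikodym_of_composition.

(** * The seminorm of a positive multiplication operator *)

Lemma Lfun_oo_ae_bounded d (X : measurableType d) (R : realType)
    (mu : {measure set X -> \bar R}) (u : X -> R) :
  u \in Lfun mu +oo%E ->
  measurable_fun setT u /\ exists M : R, {ae mu, forall x, u x <= M}.
Proof.
move=> uL; split; first exact: set_mem (sub_Lfun_mfun uL).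
have : finite_norm mu +oo%E u by exact: set_mem (sub_Lfun_finLfun uL).
rewrite /finite_norm unlock /Lnorm; case: ifPn => [_|muT0 _]; last first.
  (* For mu = 0 the norm is 0 whatever u is, but the whole space is null. *)
  exists 0, setT; split => //; apply/eqP; move: muT0; apply: contraNT.
  by rewrite lt0e measure_ge0 andbT.
have : {ae mu, forall x, (`|u x|%:E <= ess_sup mu (abse \o (EFin \o u)))%E}.
  exact: ess_sup_ge.
case: (ess_sup _ _) => [M uM _|//|uNy _].
- exists M; apply: filterS uM => x; rewrite lee_fin; apply: le_trans.
  exact: ler_norm.
- by exists 0; apply: filterS uNy => x; rewrite leeNy_eq.
Qed.

Section weighted_seminorm.
Context d (X : measurableType d) (R : realType).
Variables (mu : {measure set X -> \bar R}) (u : X -> R).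
Hypothesis u_meas : measurable_fun setT u.
Hypothesis u_ge0 : {ae mu, forall x, 0 <= u x}.
Variable M : R.
Hypothesis u_le : {ae mu, forall x, u x <= M}.
Implicit Types f g : X -> R[i].

Definition weighted_sqnorm f : R := \int[mu]_x (u x * normc (f x) ^+ 2).

Lemma normA_weighted_sqnorm f :
  normA mu (mult_op u) f = sqrtc (weighted_sqnorm f)%:C%C.
Proof.
congr sqrtc; rewrite /innerA /inner /Cintegral; congr Complex.
  apply: eq_Rintegral => x _; rewrite sqr_normcE /mult_op.
  by case: (f x) => a b /=; ring.
transitivity (\int[mu]_x (0 : R)); last by rewrite /Rintegral integral0.
apply: eq_Rintegral => x _; rewrite /mult_op.
by case: (f x) => a b /=; ring.
Qed.

Lemma normA_eq f g :
  normA mu (mult_op u) f = normA mu (mult_op u) g <->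
  weighted_sqnorm f = weighted_sqnorm g.
Proof.
rewrite !normA_weighted_sqnorm; split=> [/(congr1 (fun z => z ^+ 2))|->//].
by rewrite !sqr_sqrtc => -[].
Qed.

Lemma normA_eq0 f : normA mu (mult_op u) f = 0 <-> weighted_sqnorm f = 0.
Proof.
rewrite normA_weighted_sqnorm; split=> [/eqP|->]; last by rewrite sqrtc0.
by rewrite sqrtc_eq0 => /eqP[].
Qed.

Lemma measurable_weighted_sqnorm f : Cmeasurable f ->
  measurable_fun setT (fun x => u x * normc (f x) ^+ 2).
Proof.
by move=> mf; apply: measurable_funM => //; exact: measurable_sqr_normc.
Qed.

Lemma integrable_weighted_sqnorm f : L2 mu f ->
  mu.-integrable setT (fun x => (u x * normc (f x) ^+ 2)%:E).
Proof.
move=> /L2P[mf f_lty]; have mq := measurable_weighted_sqnorm mf.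
apply/integrableP; split; first exact/measurable_EFinP.
apply: (@le_lt_trans _ _ (\int[mu]_x (`|M|%:E * (normc (f x) ^+ 2)%:E))%E).
  apply: ae_ge0_le_integral => //.
  - by apply: measurableT_comp => //; exact/measurable_EFinP.
  - by move=> x _; rewrite lee_fin mulr_ge0// sqr_ge0.
  - by apply: measurable_funeM; exact/measurable_EFinP/measurable_sqr_normc.
  - apply: filterS2 u_ge0 u_le => x u0 uM _.
    rewrite lee_fin normrM (ger0_norm (sqr_ge0 _)) ler_wpM2r ?sqr_ge0//.
    by rewrite ger0_norm// (le_trans uM)// ler_norm.
rewrite ge0_integralZl//.
- by rewrite lte_mul_pinfty.
- by apply/measurable_EFinP/measurable_sqr_normc.
- by move=> x _; rewrite lee_fin sqr_ge0.
Qed.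

Lemma EFin_weighted_sqnorm f : L2 mu f ->
  (\int[mu]_x (u x * normc (f x) ^+ 2)%:E = (weighted_sqnorm f)%:E)%E.
Proof.
by move=> /integrable_weighted_sqnorm fi; rewrite fineK// integrable_fin_num.
Qed.

End weighted_seminorm.

(** A real multiplication operator is symmetric, so it can be moved to the other
    side of the inner product. *)
Lemma orthA_mult_op d (X : measurableType d) (R : realType)
    (mu : {measure set X -> \bar R}) (u : X -> R) (L : set (X -> R[i])) :
  orthA mu (mult_op u) L = orth mu (mult_op u @` L).
Proof.
have innerE f g : innerA mu (mult_op u) f g = inner mu f (mult_op u g).
  congr Cintegral; apply/funext => x; rewrite /mult_op.
  by case: (f x) (g x) => [a b] [a' b'] /=; congr Complex; ring.
apply/seteqP; split=> f [fL2 fL]; split=> // g.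
  by move=> [g' Lg' <-]; rewrite -innerE; exact: fL.
by move=> Lg; rewrite innerE; apply: fL; exists g.
Qed.

(** * The composition operator in the weighted seminorm *)

Section composition.
Context d (X : measurableType d) (R : realType).
Variables (mu : {sigma_finite_measure set X -> \bar R}) (phi : X -> X).
Hypothesis phi_meas : measurable_fun setT phi.
Hypothesis phi_nonsingular : pushforward mu phi `<< mu.
Hypothesis Cphi : forall f, L2 mu f -> L2 mu (comp_op phi f).
Variable u : X -> R.
Hypothesis u_meas : measurable_fun setT u.
Hypothesis u_ge0 : {ae mu, forall x, 0 <= u x}.
Variable M : R.
Hypothesis u_le : {ae mu, forall x, u x <= M}.
Implicit Types f : X -> R[i].
Local Open Scope ereal_scope.

Let J := Jfun mu phi u.
Let mJ : measurable_fun setT J.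
Proof.
exact: (measurable_Jfun phi_meas phi_nonsingular Cphi u_meas u_ge0 u_le).
Qed.
Let J_ge0 : {ae mu, forall x, 0 <= J x}.
Proof. exact: (Jfun_ge0 phi_meas phi_nonsingular Cphi u_meas u_ge0 u_le). Qed.

Lemma weighted_sqnorm_comp_op f : L2 mu f ->
  \int[mu]_x ((normc (f x) ^+ 2)%:E * J^\+ x) =
  (weighted_sqnorm mu u (comp_op phi f))%:E.
Proof.
move=> fL2; have [mf _] := (L2P mu f).1 fL2; have CfL2 := Cphi fL2.
have [mCf _] := (L2P mu _).1 CfL2.
rewrite -(EFin_weighted_sqnorm u_meas u_ge0 u_le CfL2).
rewrite (ge0_integral_Jfun phi_meas phi_nonsingular Cphi u_meas u_ge0 u_le)//.
- apply: ae_eq_integral => //.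
  + apply: emeasurable_funM; last first.
      by apply: measurable_funepos; exact/measurable_EFinP.
    by apply/measurable_EFinP; exact: (measurable_sqr_normc mCf).
  + by apply/measurable_EFinP; exact: measurable_weighted_sqnorm.
  + by apply: filterS (ae_eq_funepos_u u_ge0) => x -> _; rewrite muleC.
- by apply/measurable_EFinP; exact: measurable_sqr_normc.
- by move=> x; rewrite lee_fin sqr_ge0.
Qed.

(** The squared seminorm of C_phi f is the integral of J |f|^2, which vanishes
    exactly when f does a.e. on [J <> 0]. *)
Lemma kerA_comp_op :
  kerA mu (mult_op u) (comp_op phi) = L2_off mu [set x | J x != 0].
Proof.
have mJp : measurable_fun setT J^\+ by exact: measurable_funepos.
apply/seteqP; split=> f [fL2].
  have [mf _] := (L2P mu f).1 fL2.
  move=> /normA_eq0 q0; split=> //.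
  have := weighted_sqnorm_comp_op fL2; rewrite q0.
  have n0 x : 0 <= (normc (f x) ^+ 2)%:E * J^\+ x.
    by rewrite mule_ge0 ?funepos_ge0// lee_fin sqr_ge0.
  under eq_integral => x _ do rewrite -[_ * _]gee0_abs//.
  move=> /ae_eq_integral_abs => /(_ measurableT).
  have mn : measurable_fun setT (fun x => (normc (f x) ^+ 2)%:E).
    by apply/measurable_EFinP; exact: measurable_sqr_normc.
  move=> /(_ (emeasurable_funM mn mJp)).
  apply: filterS2 J_ge0 => x Jx0 /(_ I)/eqP + /= /eqP Jx.
  rewrite funeposE max_l// mule_eq0 => /orP[|/eqP//].
  by rewrite eqe sqrf_eq0 => /eqP/eq0_normc.
move=> f0; split=> //; apply/normA_eq0.
apply: EFin_inj; rewrite -(weighted_sqnorm_comp_op fL2).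
have [mf _] := (L2P mu f).1 fL2.
rewrite (ae_eq_integral (cst 0)) ?integral0//.
  apply: emeasurable_funM => //.
  by apply/measurable_EFinP; exact: measurable_sqr_normc.
apply: filterS f0 => x /= f0 _.
have [Jx0|/f0 ->] := eqVneq (J x) 0.
  by rewrite funeposE Jx0 maxxx mule0.
by rewrite normc0 expr0n mul0e.
Qed.

Lemma integral_Jfun_sub f : L2 mu f ->
  \int[mu]_x ((J x - (u x)%:E) * (normc (f x) ^+ 2)%:E) =
  (weighted_sqnorm mu u (comp_op phi f) - weighted_sqnorm mu u f)%:E.
Proof.
move=> fL2; have [mf _] := (L2P mu f).1 fL2.
have mn : measurable_fun setT (fun x => (normc (f x) ^+ 2)%:E).
  by apply/measurable_EFinP; exact: measurable_sqr_normc.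
have mJp : measurable_fun setT J^\+ by exact: measurable_funepos.
have iq := integrable_weighted_sqnorm u_meas u_ge0 u_le fL2.
have iJ : mu.-integrable setT (fun x => (normc (f x) ^+ 2)%:E * J^\+ x).
  apply/integrableP; split; first exact: emeasurable_funM.
  under eq_integral => x _.
    rewrite gee0_abs; first over.
    by rewrite mule_ge0 ?funepos_ge0// lee_fin sqr_ge0.
  by rewrite weighted_sqnorm_comp_op// ltry.
rewrite EFinB -weighted_sqnorm_comp_op//.
rewrite -(EFin_weighted_sqnorm u_meas u_ge0 u_le fL2).
rewrite -integralB//; apply: ae_eq_integral => //.
- apply: emeasurable_funM => //; apply: emeasurable_funB => //.
  exact/measurable_EFinP.
- apply: emeasurable_funB => //.
    exact: measurable_int iJ.
  exact: measurable_int iq.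
(* As u is finite, the product distributes over J - u even where J = +oo. *)
- apply: filterS J_ge0 => x Jx0 _.
  rewrite funeposE max_l// EFinM (muleC _ (J x)) muleBl//.
  by rewrite fin_num_adde_defl// fin_numN.
Qed.

End composition.

Theorem theorem2p7 (d : measure_display) (X : measurableType d) (R : realType)
    (mu : {sigma_finite_measure set X -> \bar R}) (u : X -> R) (phi : X -> X)
    (u_Linfty : u \in Lfun mu +oo%E) (u_ge0 : {ae mu, forall x, 0 <= u x})
    (phi_meas : measurable_fun setT phi)
    (phi_nonsingular : pushforward mu phi `<< mu)
    (Cphi_bounded : bounded_op mu (comp_op phi)) :
  let J := Jfun mu phi u in
  let S := [set x | J x != 0%E] in
  partial_isometryA mu (mult_op u) (comp_op phi) <->
  (forall f, orth mu (mult_op u @` L2_off mu S) f ->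
     (\int[mu]_x ((J x - (u x)%:E) * ((normc (f x)) ^+ 2)%:E) = 0)%E).
Proof.
move=> J S.
have [u_meas [M u_le]] := Lfun_oo_ae_bounded u_Linfty.
have [Cphi _] := Cphi_bounded.
have kerE := kerA_comp_op phi_meas phi_nonsingular Cphi u_meas u_ge0 u_le.
rewrite -orthA_mult_op -kerE.
have main f : L2 mu f ->
    normA mu (mult_op u) (comp_op phi f) = normA mu (mult_op u) f <->
    (\int[mu]_x ((J x - (u x)%:E) * ((normc (f x)) ^+ 2)%:E) = 0)%E.
  move=> fL2; rewrite normA_eq.
  rewrite (integral_Jfun_sub phi_meas phi_nonsingular Cphi u_meas u_ge0 u_le)//.
  by split=> [->|[/subr0_eq]]; first by rewrite subrr.
split=> [[_ iso] f fo|int0].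
  by apply/main; [case: fo|exact: iso].
by split=> // f fo; apply/main; [case: fo|exact: int0].
Qed.
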